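(* Let $H$ be a separable complex Hilbert space, $A\in\mathcal{B}(H)^+$, $N,E,X\in\mathcal{B}(H)$, and let $$\mathbf{T}=\begin{pmatrix}N&E\\0&X\end{pmatrix}\quad\text{on } H\oplus H.$$ Then the following hold. (1) Assume that $E=NEX$, $N^*AE=AEX$ and $N$ is $A$-isometric. Then $\mathbf{T}$ is $(A\oplus A)$-isosymmetric if and only if $X$ is $A$-isosymmetric. (2) Assume that $N$ is $A$-symmetric and $NE=EX$. Then $\mathbf{T}$ is $(A\oplus A)$-isosymmetric if and only if $X$ is $A$-isosymmetric and $AE=ANEX$.
   Context: $\mathcal{B}(H)$ is the algebra of bounded linear operators on $H$ and $\mathcal{B}(H)^+$ the set of positive (semi-definite) operators. For a positive operator $B$ and a bounded operator $S$ on a Hilbert space: $S$ is $B$-isosymmetric if $S^{*2}BS-S^*BS^2-S^*B+BS=0$; $S$ is $B$-isometric if $S^*BS=B$; $S$ is $B$-symmetric if $S^*B=BS$. $A\oplus A$ denotes the block diagonal operator on $H\oplus H$ with both diagonal entries $A$. *)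

(* Defs.v *)
From HB Require Import structures.
From mathcomp Require Import all_boot all_order all_algebra.
From mathcomp Require Import complex ring lra.
From mathcomp Require Import all_classical all_reals all_analysis.

Set Implicit Arguments.
Unset Strict Implicit.
Unset Printing Implicit Defensive.

Import Order.TTheory GRing.Theory Num.Theory.
Import numFieldNormedType.Exports.

Local Open Scope classical_set_scope.
Local Open Scope ring_scope.

(* [{dot H for Num.conj}] is linear in its first argument, conjugate-linear in
   its second one, hermitian and positive definite. *)
HB.mixin Record CompleteNormedModule_isHilbert (R : realType) H
    & CompleteNormedModule R[i] H := {
  inner : {dot H for Num.conj};
  inner_norm : forall x : H, `|x| ^+ 2 = inner x x
}.

#[short(type="hilbertType")]
HB.structure Definition Hilbert (R : realType) :=
  {H of CompleteNormedModule R[i] H & CompleteNormedModule_isHilbert R H}.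

Definition separable (T : topologicalType) :=
  exists2 D : set T, countable D & dense D.

HB.mixin Record isBoundedOp (R : realType) (U V : hilbertType R)
    (f : U -> V) := {
  bounded_op : exists M : R[i], forall x, `|f x| <= M * `|x|
}.

HB.structure Definition BoundedOp (R : realType) (U V : hilbertType R) :=
  {f of isBoundedOp R U V f & @GRing.Linear R[i] U V *:%R f}.

Notation "''B(' U , V )" := (@BoundedOp.type _ U V)
  (at level 8, format "''B(' U ,  V )") : type_scope.
Notation "''B(' H )" := (@BoundedOp.type _ H H)
  (at level 8, format "''B(' H )") : type_scope.

Section DotTheory.
Variables (C : numClosedFieldType) (U : lmodType C) (f : {dot U for Num.conj}).

Lemma dot_sym u v : f u v = (f v u)^*.
Proof. by rewrite (hermC f) /= mul1r. Qed.

Lemma dot_cauchy_schwarz u v : `|f u v| ^+ 2 <= f u u * f v v.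
Proof.
have [->|v0] := eqVneq v 0.
  by rewrite linear0r normr0 expr0n /= [f 0 0]linear0r mulr0.
have fv : 0 < f v v by rewrite dnorm_gt0.
have fvR : (f v v)^* = f v v by rewrite conj_Creal// gtr0_real.
pose a := f u v / f v v.
have aE : a^* * f u v = `|f u v| ^+ 2 / f v v.
  by rewrite /a fmorph_div /= fvR normCK mulrAC [in RHS]mulrC mulrA mulrAC mulrC mulrA.
have := dnorm_ge0 f (u - a *: v).
rewrite dnormB dnormZ linearZr_LR /= -/a aE.
have -> : (`|f u v| ^+ 2 / f v v)^* = `|f u v| ^+ 2 / f v v.
  by rewrite conj_Creal// realM ?realV ?realX ?normr_real ?gtr0_real.
rewrite {1}/a normf_div (gtr0_norm fv) => h.
rewrite -ler_pdivrMr// -subr_ge0; apply: le_trans h _.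
by rewrite le_eqVlt; apply/orP; left; apply/eqP; field; rewrite gt_eqF.
Qed.

Lemma dot_triangle u v :
  sqrtC (f (u + v) (u + v)) <= sqrtC (f u u) + sqrtC (f v v).
Proof.
have fu0 := dnorm_ge0 f u; have fv0 := dnorm_ge0 f v.
have su0 : 0 <= sqrtC (f u u) by rewrite sqrtC_ge0.
have sv0 : 0 <= sqrtC (f v v) by rewrite sqrtC_ge0.
rewrite -(@ler_pXn2r _ 2)// ?nnegrE ?addr_ge0 ?sqrtC_ge0 ?dnorm_ge0//.
rewrite sqrtCK dnormD sqrrD !sqrtCK addrAC lerD2r lerD2l.
set d := f u v.
have dR : d + d^* \is Num.real.
  by rewrite CrealE rmorphD /= conjCK addrC.
apply: (le_trans (real_ler_norm dR)); apply: (le_trans (ler_normD _ _)).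
rewrite norm_conjC -mulr2n lerMn2r /= -(@ler_pXn2r _ 2)// ?nnegrE ?mulr_ge0//.
by rewrite exprMn !sqrtCK dot_cauchy_schwarz.
Qed.
End DotTheory.

(* The Hilbert direct sum.  An alias of the product is needed because [U * V]
   already carries the max norm, which does not come from an inner product. *)
Definition dsum (U V : Type) : Type := (U * V)%type.

Section DirectSum.
Variables (R : realType) (U V : hilbertType R).
Implicit Types x y : dsum U V.

HB.instance Definition _ := GRing.Lmodule.copy (dsum U V) (U * V)%type.

Definition dsum_inner x y : R[i] := inner x.1 y.1 + inner x.2 y.2.

Fact dsum_inner_bilinear :
  (forall v, GRing.linear_for *%R (dsum_inner ^~ v))
  * (forall u, GRing.linear_for (Num.conj \; *%R) (dsum_inner u)).
Proof.
split=> [v|u] a x y; rewrite /dsum_inner /=.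
  by rewrite !linearPl /= mulrDr addrACA.
by rewrite !linearPr /= mulrDr addrACA.
Qed.

HB.instance Definition _ := bilinear_isBilinear.Build R[i] (dsum U V) (dsum U V)
  R[i] _ _ dsum_inner dsum_inner_bilinear.

Fact dsum_inner_hermitian x y :
  dsum_inner x y = (-1) ^+ false * Num.conj (dsum_inner y x).
Proof. by rewrite mul1r rmorphD /= -!dot_sym. Qed.

HB.instance Definition _ := isHermitianSesquilinear.Build R[i] (dsum U V)
  false Num.conj dsum_inner dsum_inner_hermitian.

Fact dsum_inner_gt0 x : x != 0 -> 0 < dsum_inner x x.
Proof.
case: x => u v; rewrite -pair_eqE /= negb_and /dsum_inner /=.
case/orP => h; first by rewrite ltr_wpDr ?dnorm_ge0 ?dnorm_gt0.
by rewrite ltr_wpDl ?dnorm_ge0 ?dnorm_gt0.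
Qed.

HB.instance Definition _ := isDotProduct.Build R[i] (dsum U V)
  dsum_inner dsum_inner_gt0.

Definition dsum_norm x : R[i] := sqrtC (dsum_inner x x).

Fact dsum_ler_normD x y : dsum_norm (x + y) <= dsum_norm x + dsum_norm y.
Proof. exact: (dot_triangle dsum_inner). Qed.

Fact dsum_normZ (a : R[i]) x : dsum_norm (a *: x) = `|a| * dsum_norm x.
Proof.
rewrite /dsum_norm (dnormZ dsum_inner) sqrtCM ?nnegrE ?exprn_ge0//.
by rewrite exprCK.
Qed.

Fact dsum_norm0_eq0 x : dsum_norm x = 0 -> x = 0.
Proof. by move/eqP; rewrite (sqrt_dnorm_eq0 dsum_inner) => /eqP. Qed.

HB.instance Definition _ := Lmodule_isNormed.Build R[i] (dsum U V)
  dsum_ler_normD dsum_normZ dsum_norm0_eq0.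

Fact dsum_inner_norm x : `|x| ^+ 2 = dsum_inner x x.
Proof. exact: sqrtCK. Qed.

Fact dsum_norm_sqr x : `|x| ^+ 2 = `|x.1| ^+ 2 + `|x.2| ^+ 2.
Proof. by rewrite dsum_inner_norm /dsum_inner -!inner_norm. Qed.

Fact dsum_norm_fst x : `|x.1| <= `|x|.
Proof. by rewrite -(@ler_pXn2r _ 2) ?nnegrE// dsum_norm_sqr lerDl exprn_ge0. Qed.

Fact dsum_norm_snd x : `|x.2| <= `|x|.
Proof. by rewrite -(@ler_pXn2r _ 2) ?nnegrE// dsum_norm_sqr lerDr exprn_ge0. Qed.

Fact dsum_norm_le x : `|x| <= `|x.1| + `|x.2|.
Proof.
rewrite -(@ler_pXn2r _ 2)// ?nnegrE ?addr_ge0// dsum_norm_sqr sqrrD.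
by rewrite addrAC lerDl mulrn_wge0// mulr_ge0.
Qed.

Fact dsum_complete (F : set_system (dsum U V)) :
  ProperFilter F -> cauchy F -> cvg F.
Proof.
move=> FF /cauchy_ballP Fc.
have cvgP (W : hilbertType R) (p : dsum U V -> W) :
    (forall x y, `|p x - p y| <= `|x - y|) -> exists a : W, p @ F --> a.
  move=> pL; suff /cauchy_cvg/cvg_ex : cauchy (p @ F) by [].
  apply/cauchy_ballP => e e0; have := Fc _ e0.
  rewrite /prop_near1 /= => -[[P Q] [/= FP FQ] PQ].
  exists (p @` P, p @` Q) => /=.
    by split; [apply: filterS FP | apply: filterS FQ] => x Px; exists x.
  move=> [_ _] /= [[x Px <-] [y Qy <-]].
  have := PQ (x, y) (conj Px Qy); rewrite -!ball_normE /=.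
  exact: le_lt_trans.
have [a Fa] : exists a : U, (fst : dsum U V -> U) @ F --> a.
  by apply: cvgP => x y; exact: dsum_norm_fst (x - y).
have [b Fb] : exists b : V, (snd : dsum U V -> V) @ F --> b.
  by apply: cvgP => x y; exact: dsum_norm_snd (x - y).
apply/cvg_ex; exists ((a, b) : dsum U V).
apply/cvgrPdist_lt => e e0.
have e20 : 0 < e / 2 by rewrite divr_gt0.
have Ha := (proj1 (@cvgrPdist_lt _ _ _ _ _ _ _) Fa) _ e20.
have Hb := (proj1 (@cvgrPdist_lt _ _ _ _ _ _ _) Fb) _ e20.
near=> x; apply: (le_lt_trans (dsum_norm_le _)).
rewrite [ltRHS](splitr e) ltrD//=; first by near: x; exact: Ha.
by near: x; exact: Hb.
Unshelve. all: by end_near. Qed.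

HB.instance Definition _ := Uniform_isComplete.Build (dsum U V) dsum_complete.

HB.instance Definition _ := CompleteNormedModule_isHilbert.Build R (dsum U V)
  dsum_inner_norm.
End DirectSum.

Section Operators.
Variable R : realType.
Implicit Types U V W : hilbertType R.

Fact bounded_op_zero U V : exists M : R[i], forall x : U,
  `|(\0 : U -> V) x| <= M * `|x|.
Proof. by exists 0 => x; rewrite normr0 mul0r. Qed.

HB.instance Definition _ U V :=
  isBoundedOp.Build R U V (\0 : U -> V) (@bounded_op_zero U V).

Definition zero_op U V : 'B(U, V) := (\0 : U -> V).

Lemma bounded_opP U V (f : 'B(U, V)) :
  exists2 M : R[i], 0 < M & forall x, `|f x| <= M * `|x|.
Proof.
have [M Mf] := @bounded_op _ _ _ f; exists (`|M| + 1) => [|x].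
  by rewrite ltr_wpDl.
rewrite mulrDl mul1r; apply: ler_wpDr => //.
have h : 0 <= M * `|x| by apply: le_trans (Mf x).
by apply: (le_trans (Mf x)); rewrite -(ger0_norm h) normrM normr_id.
Qed.

Section Block.
Variables (U1 U2 V1 V2 : hilbertType R).
Variables (A : 'B(U1, V1)) (B : 'B(U2, V1)) (C : 'B(U1, V2)) (D : 'B(U2, V2)).

(* The operator with block matrix  / A B \
                                   \ C D / . *)
Definition block_fun (z : dsum U1 U2) : dsum V1 V2 :=
  (A z.1 + B z.2, C z.1 + D z.2).

Fact block_fun_linear : linear block_fun.
Proof.
move=> a x y; rewrite /block_fun /= !linearP /=.
by congr (_, _); rewrite /= scalerDr addrACA.
Qed.

Fact block_fun_bounded : exists M : R[i], forall z, `|block_fun z| <= M * `|z|.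
Proof.
have [a a0 Aa] := bounded_opP A; have [b b0 Bb] := bounded_opP B.
have [c c0 Cc] := bounded_opP C; have [d d0 Dd] := bounded_opP D.
exists (a + b + (c + d)) => z; apply: (le_trans (dsum_norm_le _)) => /=.
have L1 := dsum_norm_fst z; have L2 := dsum_norm_snd z.
rewrite !mulrDl; apply: lerD; apply: (le_trans (ler_normD _ _)); apply: lerD.
- by apply: (le_trans (Aa _)); exact: ler_wpM2l (ltW a0) _ _ L1.
- by apply: (le_trans (Bb _)); exact: ler_wpM2l (ltW b0) _ _ L2.
- by apply: (le_trans (Cc _)); exact: ler_wpM2l (ltW c0) _ _ L1.
- by apply: (le_trans (Dd _)); exact: ler_wpM2l (ltW d0) _ _ L2.
Qed.

HB.instance Definition _ := GRing.isLinear.Build R[i] (dsum U1 U2) (dsum V1 V2)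
  *:%R block_fun block_fun_linear.
HB.instance Definition _ := isBoundedOp.Build R (dsum U1 U2) (dsum V1 V2)
  block_fun block_fun_bounded.

Definition block_op : 'B(dsum U1 U2, dsum V1 V2) := block_fun.

End Block.

Definition diag_op U V (A : 'B(U)) (D : 'B(V)) : 'B(dsum U V) :=
  block_op A (zero_op _ _) (zero_op _ _) D.

Definition is_adjoint U V (T : 'B(U, V)) (S : 'B(V, U)) :=
  forall x y, inner (T x) y = inner x (S y).

Section Riesz.
Variables (U : hilbertType R) (f : {scalar U}).
Hypothesis fbd : exists2 M : R[i], 0 < M & forall x, `|f x| <= M * `|x|.

Lemma parallelogram (x y : U) :
  `|x - y| ^+ 2 = (`|x| ^+ 2 + `|y| ^+ 2) *+ 2 - `|x + y| ^+ 2.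
Proof. by rewrite !inner_norm dnormB dnormD; ring. Qed.

Lemma riesz : exists z : U, forall x, f x = inner x z.
Proof.
have [[x0 fx0]|f0] := pselect (exists x, f x != 0); last first.
  exists 0 => x; rewrite linear0r; apply/eqP/negPn/negP => fx.
  by apply: f0; exists x.
pose n (x : U) : R := complex.Re `|x|.
have nE x : (n x)%:C%C = `|x| by rewrite /n RRe_real ?normr_real.
have nE2 x : (n x ^+ 2)%:C%C = `|x| ^+ 2 by rewrite rmorphXn /= nE.
have n0 x : 0 <= n x by rewrite -lecR nE; exact: normr_ge0.
have nD x y : n (x + y) <= n x + n y.
  by rewrite -lecR rmorphD /= !nE ler_normD.
have nP x y : n (x - y) ^+ 2 = (n x ^+ 2 + n y ^+ 2) *+ 2 - n (x + y) ^+ 2.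
  apply: (@complexI R).
  by rewrite rmorphB rmorphMn rmorphD /= !nE2 parallelogram.
have nH x : n (2^-1 *: x) ^+ 2 = n x ^+ 2 / 4.
  apply: (@complexI R).
  rewrite nE2 normrZ exprMn mulrC [RHS]rmorphM /= nE2; congr (_ * _).
  by rewrite ger0_norm ?invr_ge0// fmorphV rmorph_nat /= exprVn -natrX.
pose K : set U := [set x | f x = 1].
pose S := [set n x ^+ 2 | x in K].
pose d := inf S.
have Slb : lbound S 0 by move=> _ [x _ <-]; rewrite exprn_ge0.
pose F : set_system U := [set P | exists2 e : R, 0 < e &
  forall x, K x -> n x ^+ 2 < d + e -> P x].
have hinf : has_inf S.
  split; last by exists 0.
  exists (n ((f x0)^-1 *: x0) ^+ 2), ((f x0)^-1 *: x0) => //.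
  by rewrite /K /= linearZ /= mulVf.
have d0 : 0 <= d by apply: lb_le_inf => //; case: hinf.
have Kge x : K x -> d <= n x ^+ 2.
  by move=> Kx; apply: (inf_lbound hinf.2); exists x.
have FF : ProperFilter F.
  split; last split.
  - move=> [e e0 He]; have [_ [x Kx <-] rlt] := inf_adherent e0 hinf.
    exact: (He x Kx).
  - by exists 1.
  - move=> P Q [e e0 He] [e' e0' He']; exists (Num.min e e').
      by rewrite lt_min e0.
    move=> x Kx xlt; split; [apply: He => //|apply: He' => //];
    by apply: (lt_le_trans xlt); rewrite lerD2l ge_min lexx ?orbT.
  - by move=> P Q PQ [e e0 He]; exists e => // x Kx /(He x Kx)/PQ.
have Fc : cauchy F.
  apply/cauchy_ballP => e e0.
  have eE : (complex.Re e)%:C%C = e by rewrite RRe_real ?gtr0_real.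
  move: e0; rewrite -eE ltcR; move: (complex.Re e) => {eE} {}e e0.
  pose P := [set x | K x /\ n x ^+ 2 < d + e ^+ 2 / 4].
  have FP : F P.
    by exists (e ^+ 2 / 4) => //; rewrite divr_gt0 ?exprn_gt0.
  exists (P, P) => // -[x y] /= [[Kx xd] [Ky yd]].
  rewrite -ball_normE /= -nE ltcR -(@ltr_pXn2r _ 2)// ?nnegrE ?n0 ?(ltW e0)// nP.
  have : d <= n (2^-1 *: (x + y)) ^+ 2.
    apply: Kge; rewrite /K /= linearZ linearD /= Kx Ky.
    by rewrite -[1 + 1]/(2%:R) mulVf// pnatr_eq0.
  by rewrite nH; lra.
have /cvg_ex[z Fz] : cvg F by exact: cauchy_cvg.
have near_z (e : R) : 0 < e ->
    exists x, [/\ K x, n x ^+ 2 < d + e & n (z - x) < e].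
  move=> e0.
  have ez : F [set x | `|z - x| < e%:C%C].
    have eC : 0 < e%:C%C by rewrite ltcR.
    by have := Fz _ (nbhsx_ballx z _ eC); rewrite -ball_normE.
  have eK : F [set x | K x /\ n x ^+ 2 < d + e] by exists e.
  have [x [/= [Kx xd] xz]] := filter_ex (filterI eK ez).
  by exists x; split=> //; rewrite -ltcR nE.
have [M M0 Mf] := fbd.
have Kz : K z.
  apply/eqP; rewrite -subr_eq0 -normr_le0; apply/ler_addgt0Pl => e e0.
  rewrite addr0.
  have eM : 0 < e / M by rewrite divr_gt0.
  have eE : (complex.Re (e / M))%:C%C = e / M by rewrite RRe_real ?gtr0_real.
  have [|x [Kx _]] := near_z (complex.Re (e / M)); first by rewrite -ltcR eE.
  rewrite -ltcR eE nE ltr_pdivlMr// mulrC => /ltW; apply: le_trans.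
  by apply: le_trans (Mf _); rewrite linearB /= Kx.
have zd : n z ^+ 2 <= d.
  apply/ler_addgt0Pr => e e0.
  pose h := Num.min 1 (e / (6 + d *+ 2)).
  have h0 : 0 < h by rewrite lt_min ltr01 divr_gt0//; lra.
  have h1 : h <= 1 by rewrite ge_min lexx.
  have he : h * (6 + d *+ 2) <= e.
    by rewrite -ler_pdivlMr ?ge_min ?lexx ?orbT//; lra.
  have [x [Kx xd xz]] := near_z h h0.
  have zx : n z <= n (z - x) + n x by rewrite -{1}(subrK x z).
  have := n0 z; have := n0 x; have := n0 (z - x).
  have nx : n x <= d + 2 by have := n0 x; nra.
  nra.
have zmin k : f k = 0 -> `|z| ^+ 2 <= `|z - k| ^+ 2.
  move=> fk; rewrite -!nE2 lecR; apply: (le_trans zd); apply: Kge.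
  by rewrite /K /= linearB /= Kz fk subr0.
have zorth k : f k = 0 -> inner z k = 0.
  move=> fk; have [->|k0] := eqVneq k 0; first by rewrite linear0r.
  have kk : 0 < inner k k by rewrite dnorm_gt0.
  have kR : (inner k k)^* = inner k k by rewrite conj_Creal// gtr0_real.
  pose a := inner z k / inner k k.
  have := zmin (a *: k); rewrite linearZ /= fk mulr0 => /(_ erefl).
  rewrite !inner_norm dnormB dnormZ linearZr_LR /=.
  have -> : a^* * inner z k = `|a| ^+ 2 * inner k k.
    rewrite normCK /a fmorph_div /= kR; field; exact: lt0r_neq0.
  have -> : (`|a| ^+ 2 * inner k k)^* = `|a| ^+ 2 * inner k k.
    by rewrite conj_Creal// realM ?realX ?normr_real ?gtr0_real.
  set b := _ * inner k k.
  rewrite -subr_ge0 (_ : _ - _ = - b); last by ring.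
  rewrite oppr_ge0 /b.
  rewrite pmulr_lle0// => a0; have : `|a| ^+ 2 = 0.
    by apply/le_anti; rewrite a0 exprn_ge0.
  move/eqP; rewrite expf_eq0 normr_eq0 mulf_eq0 invr_eq0 (gt_eqF kk) orbF.
  by move/eqP.
have z0 : z != 0 by apply/eqP => z0; have := Kz; rewrite /K /= z0 linear0 =>
  /eqP; rewrite eq_sym oner_eq0.
have zz : 0 < inner z z by rewrite dnorm_gt0.
exists ((inner z z)^-1 *: z) => x; rewrite linearZr_LR /= fmorphV /=.
rewrite conj_Creal ?gtr0_real//.
have : inner z (x - f x *: z) = 0.
  by apply: zorth; rewrite linearB linearZ /= Kz mulr1 subrr.
rewrite dot_sym linearBl linearZl_LR /= => /eqP.
rewrite conjC_eq0 subr_eq0 => /eqP ->.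
by rewrite mulrCA mulVf ?mulr1// gt_eqF.
Qed.

End Riesz.

Lemma adjoint_subproof U V (T : 'B(U, V)) : exists S : 'B(V, U), is_adjoint T S.
Proof.
have [M M0 TM] := bounded_opP T.
have CS (W : hilbertType R) (x y : W) : `|inner x y| <= `|x| * `|y|.
  rewrite -(@ler_pXn2r _ 2)// ?nnegrE ?mulr_ge0// exprMn !inner_norm.
  exact: dot_cauchy_schwarz.
have /choice[S SP] : forall y, exists z, forall x, inner (T x) y = inner x z.
  move=> y; have fl : scalar (fun x => inner (T x) y).
    by move=> a u v; rewrite linearP linearPl.
  pose f : {scalar U} := HB.pack (fun x => inner (T x) y)
    (GRing.isLinear.Build R[i] U R[i] *%R _ fl).
  apply: (@riesz U f).
  exists (M * (`|y| + 1)) => [|x]; first by rewrite mulr_gt0// ltr_wpDl.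
  by apply: (le_trans (CS _ _ _)); rewrite mulrAC ler_pM// lerDl ler01.
have eqS z z' : (forall x : U, inner x z = inner x z') -> z = z'.
  move=> zz'; apply/eqP; rewrite -subr_eq0 -(dnorm_eq0 inner).
  by rewrite linearBr /= zz' subrr.
have Slin : linear S.
  move=> a u v; apply: eqS => x.
  by rewrite -SP !linearPr /= !SP.
have Sbd : exists M : R[i], forall y, `|S y| <= M * `|y|.
  exists M => y; have [->|y0] := eqVneq (S y) 0.
    by rewrite normr0 mulr_ge0// ltW.
  rewrite -(@ler_pM2l _ `|S y|) ?normr_gt0// -expr2 inner_norm -SP.
  apply: (le_trans (real_ler_norm _)).
    by rewrite SP ger0_real// dnorm_ge0.
  apply: (le_trans (CS _ _ _)); rewrite mulrA ler_wpM2r// mulrC.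
  exact: TM.
pose mL := GRing.isLinear.Build R[i] V U *:%R S Slin.
pose mB := isBoundedOp.Build R V U S Sbd.
pose S' : 'B(V, U) := HB.pack S mL mB.
by exists S' => x y; rewrite SP.
Qed.

Definition adjoint U V (T : 'B(U, V)) : 'B(V, U) :=
  projT1 (cid (adjoint_subproof T)).

Lemma adjointP U V (T : 'B(U, V)) : is_adjoint T (adjoint T).
Proof. exact: projT2 (cid (adjoint_subproof T)). Qed.

Section OneOperator.
Variable H : hilbertType R.
Implicit Types B S : 'B(H).

Definition positive_op B := forall x, 0 <= inner (B x) x.

Definition isosymmetric B S :=
  (adjoint S \o adjoint S \o B \o S) \- (adjoint S \o B \o S \o S)
    \- (adjoint S \o B) \+ (B \o S) = (\0 : H -> H).

Definition isometric B S := adjoint S \o B \o S = B :> (H -> H).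

Definition op_symmetric B S := adjoint S \o B = B \o S.

End OneOperator.

End Operators.

(* Main.v *)
Require Import Defs.
From HB Require Import structures.
From mathcomp Require Import all_boot all_order all_algebra.
From mathcomp Require Import all_classical all_reals all_analysis.
From mathcomp Require Import complex ring.
Import Order.TTheory GRing.Theory Num.Theory.
Import numFieldNormedType.Exports.
Local Open Scope classical_set_scope.
Local Open Scope ring_scope.

(** Write T for the operator with rows (N, E) and (0, X), and D(A, S) for the
    defect S*S*AS - S*ASS - S*A + AS, so that S is A-isosymmetric exactly when
    D(A, S) = 0.  Multiplying out, D(A (+) A, T) is the block operator with rows
    (D(A, N), upper) and (lower, corner + D(A, X)), where
      - upper  = N*N*AE - N*ANE - N*AEX + AE,
      - corner = E*N*AE + X*E*AE - E*ANE - E*AEX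
    ([iso_defect_triangular]).  A positive operator on a complex space is
    self-adjoint ([positive_selfadjoint]), and for self-adjoint A the lower
    block is minus the adjoint of the upper one ([inner_lower_defect]), because
    D(A (+) A, T) is then skew-adjoint.  So T is isosymmetric as soon as the
    three other blocks vanish ([isosymmetric_triangular]).

    In both situations of the theorem D(A, N) = 0 and the corner term cancels:
      - if N*AN = A and N*AE = AEX, taking adjoints in the second identity gives
        X*E*A = E*AN; these relations also cancel the upper block, leaving
        D(A, X) = 0 alone;
      - if N*A = AN and NE = EX, then X*E* = E*N*, all four corner terms equal
        E*ANE up to sign, and the upper block reduces to AE - ANEX, which is the
        additional condition. *)

Section HilbertOperators.
Context {R : realType}.
Implicit Types U V : hilbertType R.

Lemma inner_ext {U} (z z' : U) :
  (forall x, inner z x = inner z' x) -> z = z'.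
Proof.
move=> zz'; apply/eqP; rewrite -subr_eq0 -(dnorm_eq0 inner).
by rewrite linearBl /= zz' subrr.
Qed.

Lemma inner_adjointl {U V} (T : 'B(U, V)) x y :
  inner (adjoint T y) x = inner y (T x).
Proof. by rewrite dot_sym -adjointP -dot_sym. Qed.

(** Polarization: the form [f x y] measuring the failure of symmetry vanishes on
    the diagonal, since <A z, z> is real.  Expanding it at x + y shows
    that it is antisymmetric, and expanding it at x + i y that it is symmetric. *)
Lemma positive_selfadjoint {U} (A : 'B(U)) : positive_op A ->
  forall x y, inner (A x) y = inner x (A y).
Proof.
move=> posA x y.
pose f x y := inner (A x) y - inner x (A y).
have fxx z : f z z = 0.
  by rewrite /f [inner z _]dot_sym conj_Creal ?subrr// ger0_real// posA.
have fD a b : f (a + b) (a + b) = f a a + f b b + (f a b + f b a).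
  by rewrite /f !linearD /= !linearDl /=; ring.
have fC a b : f a b + f b a = 0 by have := fD a b; rewrite !fxx !add0r.
have fiC : 'i * (f y x - f x y) = 0.
  rewrite -[RHS](fC x ('i *: y)) /f !linearZ /= !linearZl_LR /=.
  by rewrite conjCi -[_ *: _]/(_ * _); ring.
have /eqP : f x y *+ 2 = 0.
  move/eqP: fiC; rewrite mulf_eq0 (negPf (neq0Ci _)) /= subr_eq0 => /eqP fxy.
  by rewrite mulr2n -{2}fxy fC.
by rewrite mulrn_eq0 /= subr_eq0 => /eqP.
Qed.

Lemma adjoint_block {U1 U2 V1 V2 : hilbertType R}
    (A : 'B(U1, V1)) (B : 'B(U2, V1)) (C : 'B(U1, V2)) (D : 'B(U2, V2)) z :
  adjoint (block_op A B C D) z =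
  block_op (adjoint A) (adjoint C) (adjoint B) (adjoint D) z.
Proof.
apply: inner_ext => w; rewrite inner_adjointl.
case: z w => [z1 z2] [w1 w2]; rewrite /inner /= /dsum_inner /=.
rewrite !linearDl !linearDr /= !inner_adjointl; ring.
Qed.

(** A plain function rather than an element of ['B(U)]: all later computations
    are pointwise. *)
Definition iso_defect {U} (B S : 'B(U)) x : U :=
  adjoint S (adjoint S (B (S x))) - adjoint S (B (S (S x)))
    - adjoint S (B x) + B (S x).

Lemma isosymmetricP {U} (B S : 'B(U)) :
  isosymmetric B S <-> forall x, iso_defect B S x = 0.
Proof.
split=> [h x|h]; last by apply/funext => x; exact: h.
by have := congr1 (fun f => f x) h.
Qed.

Lemma adjoint_zero {U V} (y : V) : adjoint (zero_op U V) y = 0.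
Proof. by apply: inner_ext => x; rewrite inner_adjointl /= linear0r linear0l. Qed.

(** The next three functions collect the terms involving [E] in the block matrix
    of the defect of the upper triangular operator with entries [N], [E], [X]:
    the upper right block, the lower left block, and the part of the lower right
    block that is added to the defect of [X] itself. *)
Definition upper_defect {U V} (A N : 'B(U)) (E : 'B(V, U)) (X : 'B(V)) v : U :=
  adjoint N (adjoint N (A (E v))) - adjoint N (A (N (E v)))
    - adjoint N (A (E (X v))) + A (E v).

Definition lower_defect {U V} (A N : 'B(U)) (E : 'B(V, U)) (X : 'B(V)) u : V :=
  adjoint E (adjoint N (A (N u))) + adjoint X (adjoint E (A (N u)))
    - adjoint E (A (N (N u))) - adjoint E (A u).

Definition corner_defect {U V} (A N : 'B(U)) (E : 'B(V, U)) (X : 'B(V)) v : V :=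
  adjoint E (adjoint N (A (E v))) + adjoint X (adjoint E (A (E v)))
    - adjoint E (A (N (E v))) - adjoint E (A (E (X v))).

Lemma iso_defect_triangular {U V} (A N : 'B(U)) (E : 'B(V, U)) (B X : 'B(V))
    u v :
  iso_defect (diag_op A B) (block_op N E (zero_op U V) X) (u, v) =
  (iso_defect A N u + upper_defect A N E X v,
   lower_defect A N E X u + (corner_defect A N E X v + iso_defect B X v)).
Proof.
rewrite /iso_defect !adjoint_block /= /block_fun /= !adjoint_zero !addr0 !add0r.
(* Testing against a vector turns each component into an identity between
   scalars, which is a mere rearrangement of terms. *)
congr pair; rewrite /upper_defect /lower_defect /corner_defect /iso_defect /=.
  apply: inner_ext => w; rewrite !linearD /= !(linearDl, linearBl) /=.
  ring.
apply: inner_ext => w; rewrite !linearD /= !(linearDl, linearBl) /=.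
ring.
Qed.

(** The defect of the triangular operator is skew-adjoint when [A] is
    self-adjoint, because taking the adjoint exchanges S*S*AS with S*ASS and
    S*A with AS.  This is the off-diagonal part of that fact; it spares a
    separate analysis of the lower left block. *)
Lemma inner_lower_defect {U V} (A N : 'B(U)) (E : 'B(V, U)) (X : 'B(V)) u v :
  (forall x y, inner (A x) y = inner x (A y)) ->
  inner (lower_defect A N E X u) v = - inner u (upper_defect A N E X v).
Proof.
move=> selfA; rewrite /lower_defect /upper_defect !(linearDl, linearDr) /=.
rewrite !(linearNl, linearNr) /= !inner_adjointl !selfA -!adjointP; ring.
Qed.

(** The blocks of the defect are read off by evaluating at (u, 0) and (0, v);
    conversely the lower left block vanishes with the upper right one, by
    skew-adjointness. *)
Lemma isosymmetric_triangular {U V} (A N : 'B(U)) (E : 'B(V, U)) (B X : 'B(V)) :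
  (forall x y, inner (A x) y = inner x (A y)) ->
  isosymmetric (diag_op A B) (block_op N E (zero_op U V) X) <->
  [/\ isosymmetric A N, forall v, upper_defect A N E X v = 0 &
      forall v, corner_defect A N E X v + iso_defect B X v = 0].
Proof.
move=> selfA; rewrite isosymmetricP.
split=> [defT0|[/isosymmetricP defN0 up0 low0] [u v]].
  have def0 u v := etrans (esym (iso_defect_triangular A N E B X u v))
                          (defT0 (u, v)).
  have defN0 u : iso_defect A N u = 0.
    have /(congr1 fst) /= := def0 u 0.
    by rewrite /upper_defect !linear0 !addr0.
  have up0 v : upper_defect A N E X v = 0.
    by have /(congr1 fst) /= := def0 0 v; rewrite defN0 add0r.
  split=> [|//|v]; first exact/isosymmetricP.
  have /(congr1 snd) /= := def0 0 v.
  by rewrite {1}/lower_defect !linear0 !add0r.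
rewrite iso_defect_triangular defN0 up0 low0 !addr0; congr pair.
apply: inner_ext => w.
by rewrite (inner_lower_defect _ _ _ _ _ w selfA) up0 linear0r linear0l oppr0.
Qed.

Lemma isometric_isosymmetric {U} (A N : 'B(U)) :
  isometric A N -> isosymmetric A N.
Proof.
move=> isoN; have NAN u : adjoint N (A (N u)) = A u.
  by have := congr1 (@^~ u) isoN.
by apply/isosymmetricP => u; rewrite /iso_defect !NAN addrAC subrK subrr.
Qed.

Lemma op_symmetric_isosymmetric {U} (A N : 'B(U)) :
  op_symmetric A N -> isosymmetric A N.
Proof.
move=> symN; have NA u : adjoint N (A u) = A (N u).
  by have := congr1 (@^~ u) symN.
by apply/isosymmetricP => u; rewrite /iso_defect !NA subrr sub0r addNr.
Qed.

(** The common form of the two cases N*AN = A and N*A = AN: what [E] contributes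
    to the lower right block cancels, and only the upper block can still tie
    [E] to the other operators. *)
Corollary isosymmetric_triangular_corner0 {U V} (A N : 'B(U)) (E : 'B(V, U))
    (B X : 'B(V)) :
  (forall x y, inner (A x) y = inner x (A y)) -> isosymmetric A N ->
  (forall v, corner_defect A N E X v = 0) ->
  isosymmetric (diag_op A B) (block_op N E (zero_op U V) X) <->
  isosymmetric B X /\ forall v, upper_defect A N E X v = 0.
Proof.
move=> selfA isoN corner0; rewrite (isosymmetric_triangular _ _ _ _ _ selfA).
split=> [[_ up0 low0]|[/isosymmetricP defX0 up0]].
  by split=> //; apply/isosymmetricP => v; rewrite -[LHS]add0r -(corner0 v) low0.
by split=> // v; rewrite corner0 defX0 addr0.
Qed.

End HilbertOperators.

Theorem theorem4p3 (R : realType) (H : hilbertType R) (sepH : separable H)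
    (A N E X : 'B(H)) (posA : positive_op A) :
  let T := block_op N E (zero_op H H) X in
  (E = N \o E \o X :> (H -> H) ->
   adjoint N \o A \o E = A \o E \o X ->
   isometric A N ->
   (isosymmetric (diag_op A A) T <-> isosymmetric A X)) /\
  (op_symmetric A N ->
   N \o E = E \o X ->
   (isosymmetric (diag_op A A) T <->
    isosymmetric A X /\ A \o E = A \o N \o E \o X)).
Proof.
move=> T; have selfA := positive_selfadjoint A posA; split.
  move=> _ AE isoN.
  have NAE v : adjoint N (A (E v)) = A (E (X v)).
    by have := congr1 (@^~ v) AE.
  have NAN u : adjoint N (A (N u)) = A u by have := congr1 (@^~ u) isoN.
  have XEA u : adjoint X (adjoint E (A u)) = adjoint E (A (N u)).
    apply: inner_ext => w; rewrite !inner_adjointl selfA -NAE -adjointP.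
    by rewrite selfA.
  have up0 v : upper_defect A N E X v = 0.
    by rewrite /upper_defect !NAE NAN addrAC subrK subrr.
  have corner0 v : corner_defect A N E X v = 0.
    by rewrite /corner_defect NAE XEA addrK subrr.
  have {}isoN := isometric_isosymmetric _ _ isoN.
  rewrite (isosymmetric_triangular_corner0 _ _ _ _ _ selfA isoN corner0).
  by split=> [[]|].
move=> symN intE.
have NA u : adjoint N (A u) = A (N u) by have := congr1 (@^~ u) symN.
have NE v : N (E v) = E (X v) by have := congr1 (@^~ v) intE.
have XE y : adjoint X (adjoint E y) = adjoint E (adjoint N y).
  by apply: inner_ext => w; rewrite !inner_adjointl NE.
have upE v : upper_defect A N E X v = A (E v) - A (N (E (X v))).
  by rewrite /upper_defect !NA subrr sub0r addrC.
have corner0 v : corner_defect A N E X v = 0.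
  by rewrite /corner_defect XE NA !NE addrK subrr.
have isoN := op_symmetric_isosymmetric _ _ symN.
rewrite (isosymmetric_triangular_corner0 _ _ _ _ _ selfA isoN corner0).
split=> -[isoX h]; split=> //.
  by apply/funext => v /=; apply/eqP; rewrite -subr_eq0 -upE h.
by move=> v; rewrite upE; have /= -> := congr1 (@^~ v) h; rewrite subrr.
Qed.
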